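(* Let $\mathcal{M}$ be an $m$-dimensional manifold of class $C^1$ and let $f:\mathbb{R}\to\mathcal{M}$ be a continuous curve admitting left and right derivatives $f'(\bar t^-)$ and $f'(\bar t^+)$ at a point $\bar t\in\mathbb{R}$. Then any compact set $\Lambda\subseteq\mathrm{Lin}(\mathbb{R},T_{f(\bar t)}\mathcal{M})$ containing an arc connecting $f'(\bar t^+)$ and $f'(\bar t^-)$ is a QDQ of $f$ at $(\bar t,f(\bar t))$ in the direction of $\mathbb{R}$. Conversely, any QDQ of $f$ at $(\bar t,f(\bar t))$ in the direction of $\mathbb{R}$ necessarily contains a connected set containing $\{f'(\bar t^+),f'(\bar t^-)\}$.
   Context: Notation: $\rightsquigarrow$ denotes a set-valued map (a single-valued map $f$ is regarded as the set-valued map $t\mapsto\{f(t)\}$); $\mathrm{Lin}(V,W)$ is the space of linear maps $V\to W$, and $\mathrm{Lin}(\mathbb{R},T_{f(\bar t)}\mathcal{M})$ is identified with $T_{f(\bar t)}\mathcal{M}$; an arc connecting two points is the image of a continuous curve defined on a compact interval with these points as endpoints; $B_\delta$ is the ball of radius $\delta$ centered at $0$ (taking open or closed balls gives equivalent definitions); $d(\cdot,\Lambda)$ is the distance to $\Lambda$ for a norm on $\mathrm{Lin}(\mathbb{R}^n,\mathbb{R}^m)$. A modulus is a non-decreasing function $\rho:[0,+\infty)\to[0,+\infty)$ with $\lim_{\delta\to0^+}\rho(\delta)=0$. Definition (QDQ, Euclidean case). Let $F:\mathbb{R}^n\rightsquigarrow\mathbb{R}^m$ be a set-valued map, $(\bar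 x,\bar y)\in\mathbb{R}^n\times\mathbb{R}^m$, $\Lambda\subset\mathrm{Lin}(\mathbb{R}^n,\mathbb{R}^m)$ a compact set, and $\Gamma\subseteq\mathbb{R}^n$ any subset. $\Lambda$ is a Quasi Differential Quotient (QDQ) of $F$ at $(\bar x,\bar y)$ in the direction of $\Gamma$ if there exist $\delta^*\in(0,+\infty]$ and a modulus $\rho$ such that for every $\delta\in(0,\delta^* )$ there is a continuous map $(L_\delta,h_\delta):(\bar x+B_\delta)\cap\Gamma\to\mathrm{Lin}(\mathbb{R}^n,\mathbb{R}^m)\times\mathbb{R}^m$ such that, for all $x\in(\bar x+B_\delta)\cap\Gamma$, $$d(L_\delta(x),\Lambda)\le\rho(\delta),\qquad |h_\delta(x)|\le\delta\rho(\delta),\qquad \bar y+L_\delta(x)\cdot(x-\bar x)+h_\delta(x)\in F(x).$$ Definition (QDQ on manifolds). Let $\mathcal{N},\mathcal{M}$ be $C^1$ manifolds of dimensions $n,m$, $\tilde G:\mathcal{N}\rightsquigarrow\mathcal{M}$ a set-valued map, $(\bar x,\bar y)\in\mathcal{N}\times\mathcal{M}$, $\tilde\Lambda\subset\mathrm{Lin}(T_{\bar x}\mathcal{N},T_{\bar y}\mathcal{M})$ compact, $\tilde\Gamma\subseteq\mathcal{N}$ any subset. Let $\phi:U\to\mathbb{R}^n$, $\psi:V\to\mathbb{R}^m$ be charts on neighborhoods of $\bar x$, $\bar y$ with $\phi(\bar x)=0$, $\psi(\bar y)=0$, and let $G:=\psi\circ\tilde G\circ\phi^{-1}$ on $\phi(U)$,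 extended arbitrarily to a set-valued map $\mathbb{R}^n\rightsquigarrow\mathbb{R}^m$. $\tilde\Lambda$ is a QDQ of $\tilde G$ at $(\bar x,\bar y)$ in the direction of $\tilde\Gamma$ if $\Lambda:=D\psi(\bar y)\circ\tilde\Lambda\circ D\phi^{-1}(0)$ is a QDQ of $G$ at $(0,0)$ in the direction of $\Gamma:=\phi(\tilde\Gamma\cap U)$. (This notion does not depend on the choice of charts.) *)

(* Defs.v *)
(* Vectors are row vectors: Lin(R^n, R^m) is
   'M[R]_(n, m) acting by u |-> u *m L, as in the library's jacobian.  The
   norms on 'rV[R]_n and 'M[R]_(n, m) are the library's (max norms). *)
From HB Require Import structures.
From mathcomp Require Import all_boot all_order all_algebra.
From mathcomp Require Import all_classical all_reals all_analysis.
Import Order.TTheory GRing.Theory Num.Theory.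
Import numFieldNormedType.Exports.

Set Implicit Arguments.
Unset Strict Implicit.
Unset Printing Implicit Defensive.

Local Open Scope classical_set_scope.
Local Open Scope ring_scope.

Lemma diff_near_eq (R : realType) (V W : normedModType R) (f g : V -> W) x :
  (\forall y \near x, f y = g y) -> differentiable g x ->
  differentiable f x /\ 'd f x = 'd g x :> (V -> W).
Proof.
move=> fg dg.
have fgx : f x = g x by apply: nbhs_singleton fg.
have E : f \o shift x = cst (f x) + 'd g x +o_ 0 id.
  apply/eqaddoP => _/posnumP[e].
  have /eqaddoP/(_ e%:num)/(_ [gt0 of e%:num]) H := diff_locally dg.
  have fg' : \forall h \near 0, f (h + x) = g (h + x).
    by move: fg; rewrite (near_shift 0 x) subr0.
  near=> h.
  have -> : (f \o shift x - (cst (f x) + 'd g x)) h =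
      (g \o shift x - (cst (g x) + 'd g x)) h.
    rewrite !fctE /= fgx; congr (_ - _).
    by near: h.
  by near: h.
have D := diff_unique (diff_continuous dg) E.
split=> //; apply/diff_locallyP; split.
  by rewrite D; exact: diff_continuous.
by rewrite D.
Unshelve. all: by end_near. Qed.

Lemma cvg_mx (R : realType) (T : Type) (F : set_system T) (FF : Filter F)
   n m (G : T -> 'M[R]_(n, m)) (A : 'M[R]_(n, m)) :
  (forall i j, G x i j @[x --> F] --> A i j) -> G @ F --> A.
Proof.
move=> H; apply/cvg_ballP => e e0.
have : \near F, forall i j, ball (A i j) e (G F i j).
  apply: filter_forall => i; apply: filter_forall => j.
  by move/cvg_ballP : (H i j); apply.
by apply: filterS => x Hx; split.
Qed.

Lemma cvg_mulmx (R : realType) (T : Type) (F : set_system T) (FF : Filter F)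
   n m p (G : T -> 'M[R]_(n, m)) (H : T -> 'M[R]_(m, p))
   (A : 'M[R]_(n, m)) (B : 'M[R]_(m, p)) :
  G @ F --> A -> H @ F --> B -> G x *m H x @[x --> F] --> A *m B.
Proof.
move=> GA HB; apply: cvg_mx => i j; rewrite mxE.
under eq_cvg do rewrite mxE.
apply: cvg_big => [|k _]; first by move=> x; exact: add_continuous.
 apply: cvgM.
  exact: (cvg_comp _ _ GA (@coord_continuous _ _ _ i k A)).
exact: (cvg_comp _ _ HB (@coord_continuous _ _ _ k j B)).
Qed.

Lemma jacobian_comp (R : realType) n m p (f : 'rV[R]_n -> 'rV[R]_m)
   (g : 'rV[R]_m -> 'rV[R]_p) x :
  differentiable f x -> differentiable g (f x) ->
  jacobian (g \o f) x = jacobian f x *m jacobian g (f x).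
Proof.
move=> df dg; apply/row_matrixP => i.
rewrite !rowE mulmxA !mul_rV_lin1.
by rewrite diff_comp.
Qed.

Lemma jacobian_near_eq (R : realType) n m (f g : 'rV[R]_n -> 'rV[R]_m) x :
  (\forall y \near x, f y = g y) -> differentiable g x ->
  differentiable f x /\ jacobian f x = jacobian g x.
Proof.
move=> fg /(diff_near_eq fg)[df D]; split; first exact: df.
exact: (congr1 (@lin1_mx R n m) D).
Qed.

Lemma jacobian_id (R : realType) n (x : 'rV[R]_n) : jacobian idfun x = 1%:M.
Proof.
by apply/row_matrixP => i; rewrite !rowE mul_rV_lin1 mulmx1 diff_val.
Qed.

(* The total functions chart_map and chart_inv are meaningful only on chart_dom
   and on its image; both are homeomorphisms between these open sets. *)
Record chart (R : realType) (m : nat) (X : topologicalType) := Chart {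
  chart_map :> X -> 'rV[R]_m;
  chart_inv : 'rV[R]_m -> X;
  chart_dom : set X;
  chart_dom_open : open chart_dom;
  chart_img_open : open (chart_map @` chart_dom);
  chart_mapK : forall p, chart_dom p -> chart_inv (chart_map p) = p;
  chart_map_continuous :
    forall p, chart_dom p -> {for p, continuous chart_map};
  chart_inv_continuous :
    forall y, (chart_map @` chart_dom) y -> {for y, continuous chart_inv} }.

(* To be used with A open. *)
Definition C1_on (R : realType) (n m : nat) (f : 'rV[R]_n -> 'rV[R]_m)
    (A : set 'rV[R]_n) : Prop :=
  forall x, A x -> differentiable f x /\ {for x, continuous (jacobian f)}.

Definition transition (R : realType) (m : nat) (X : topologicalType)
    (c d : chart R m X) : 'rV[R]_m -> 'rV[R]_m :=
  d \o chart_inv c.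

Definition C1_transition (R : realType) (m : nat) (X : topologicalType)
    (c d : chart R m X) : Prop :=
  C1_on (transition c d) (c @` (chart_dom c `&` chart_dom d)).

Definition C1_compatible (R : realType) (m : nat) (X : topologicalType)
    (c d : chart R m X) : Prop :=
  C1_transition c d /\ C1_transition d c.

(* A C^1 structure is a maximal C^1 atlas. *)
Record C1manifold (R : realType) (m : nat) := MkC1manifold {
  mfd_sort :> topologicalType;
  mfd_hausdorff : hausdorff_space mfd_sort;
  mfd_second_countable : @second_countable mfd_sort;
  atlas : set (chart R m mfd_sort);
  atlas_cover : forall p, exists2 c, atlas c & chart_dom c p;
  atlas_compatible : forall c d, atlas c -> atlas d -> C1_compatible c d;
  atlas_maximal :
    forall c, (forall d, atlas d -> C1_compatible c d) -> atlas c }.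

Section transition_theory.
Context {R : realType} {m : nat} {X : topologicalType}.
Implicit Types c d e : chart R m X.

Lemma transition_near c d e p : chart_dom c p -> chart_dom e p ->
  \forall y \near c p, transition c d y = (transition e d \o transition c e) y.
Proof.
move=> cp ep.
have cinv : {for c p, continuous (chart_inv c)}.
  by apply: chart_inv_continuous; exists p.
have H : \forall y \near c p, chart_dom e (chart_inv c y).
  apply: cinv; rewrite chart_mapK//; apply: open_nbhs_nbhs.
  by split => //; exact: chart_dom_open.
near=> y; rewrite /transition /=.
rewrite chart_mapK//; near: y; exact: H.
Unshelve. all: by end_near. Qed.

Lemma transition_mx_comp c d e p : chart_dom c p -> chart_dom d p ->
  chart_dom e p -> C1_transition c e -> C1_transition e d ->
  differentiable (transition c d) (c p) /\
  jacobian (transition c d) (c p) =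
  jacobian (transition c e) (c p) *m jacobian (transition e d) (e p).
Proof.
move=> cp dp ep ce ed.
have dce : differentiable (transition c e) (c p).
  by have [] := ce (c p); [exists p|].
have ced : transition c e (c p) = e p by rewrite /transition /= chart_mapK.
have ded : differentiable (transition e d) (transition c e (c p)).
  by rewrite ced; have [] := ed (e p); [exists p|].
have [df D] := jacobian_near_eq (transition_near d cp ep)
  (differentiable_comp dce ded).
by split; [exact: df|rewrite D (jacobian_comp dce ded) ced].
Qed.

Lemma C1_transition_trans (A : set (chart R m X)) c d :
  (forall p, exists2 e, A e & chart_dom e p) ->
  (forall e, A e -> C1_compatible c e) ->
  (forall e, A e -> C1_compatible d e) ->
  C1_transition c d.
Proof.
move=> cov cA dA _ [p [cp dp] <-].
have [e Ae ep] := cov p.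
have [ce _] := cA _ Ae; have [_ ed] := dA _ Ae.
split; first by case: (transition_mx_comp cp dp ep ce ed).
have cinvp : {for c p, continuous (chart_inv c)}.
  by apply: chart_inv_continuous; exists p.
have near_dom e' : chart_dom e' p ->
    \forall y \near c p, chart_dom e' (chart_inv c y).
  move=> e'p; apply: cinvp; rewrite chart_mapK//.
  by apply: open_nbhs_nbhs; split => //; apply: chart_dom_open.
have near_img : \forall y \near c p, (c @` chart_dom c) y.
  by apply: open_nbhs_nbhs; split; [exact: chart_img_open|exists p].
have near_jac : \forall y \near c p, jacobian (transition c e) y *m
    jacobian (transition e d) (transition c e y) = jacobian (transition c d) y.
  near=> y.
  have [q cq qy] : (c @` chart_dom c) y by near: y.
  have dq : chart_dom d q.
    by rewrite -(chart_mapK cq) qy; near: y; exact: near_dom.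
  have eq : chart_dom e q.
    by rewrite -(chart_mapK cq) qy; near: y; exact: near_dom.
  rewrite -qy; have [_ ->] := transition_mx_comp cq dq eq ce ed.
  by rewrite /transition /= chart_mapK.
apply: (cvg_trans (near_eq_cvg near_jac)).
have [_ ->] := transition_mx_comp cp dp ep ce ed.
apply: cvg_mulmx.
  by have [] := ce (c p); [exists p|].
have ced : transition c e (c p) = e p by rewrite /transition /= chart_mapK.
have [dce _] := ce (c p) (ex_intro2 _ _ _ (conj cp ep) erefl).
have [_] := ed (e p) (ex_intro2 _ _ _ (conj ep dp) erefl).
rewrite -ced => ced'.
exact: (continuous_comp (differentiable_continuous dce) ced').
Unshelve. all: by end_near. Qed.

End transition_theory.

Section manifold_of_atlas.
Context {R : realType} {m : nat} (X : topologicalType).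
Hypotheses (XH : hausdorff_space X) (XS : @second_countable X).
Variable A : set (chart R m X).
Hypothesis A_cover : forall p, exists2 c, A c & chart_dom c p.
Hypothesis A_compatible : forall c d, A c -> A d -> C1_compatible c d.

Let A_max : set (chart R m X) := [set c | forall d, A d -> C1_compatible c d].

Let sub_max : A `<=` A_max.
Proof. by move=> c Ac d Ad; exact: A_compatible. Qed.

Let max_cover p : exists2 c, A_max c & chart_dom c p.
Proof. by have [c Ac cp] := A_cover p; exists c => //; exact: sub_max. Qed.

Let max_compatible c d : A_max c -> A_max d -> C1_compatible c d.
Proof. by move=> Ac Ad; split; exact: (C1_transition_trans A_cover). Qed.

Let max_maximal c : (forall d, A_max d -> C1_compatible c d) -> A_max c.
Proof. by move=> cA d Ad; apply: cA; exact: sub_max. Qed.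

Definition manifold_of_atlas : C1manifold R m :=
  MkC1manifold XH XS max_cover max_compatible max_maximal.

End manifold_of_atlas.

Section real_line.
Context {R : realType}.

Let line_map : R -> 'rV[R]_1 := fun t => const_mx t.
Let line_inv : 'rV[R]_1 -> R := fun u => u 0 0.

Let line_mapK t : line_inv (line_map t) = t.
Proof. by rewrite /line_inv /line_map mxE. Qed.

Let line_invK u : line_map (line_inv u) = u.
Proof. by apply/rowP => j; rewrite mxE ord1. Qed.

Let line_img : line_map @` [set: R] = setT.
Proof. by rewrite -subTset => u _; exists (line_inv u). Qed.

Let line_img_open : open (line_map @` [set: R]).
Proof. by rewrite line_img; exact: openT. Qed.

Let line_map_continuous t : [set: R] t -> {for t, continuous line_map}.
Proof.
move=> _; apply: cvg_mx => i j; rewrite mxE.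
under eq_cvg do rewrite mxE.
exact: cvg_id.
Qed.

Let line_inv_continuous u :
  (line_map @` [set: R]) u -> {for u, continuous line_inv}.
Proof. by move=> _; exact: coord_continuous. Qed.

Definition line_chart : chart R 1 R :=
  Chart openT line_img_open (fun t _ => line_mapK t) line_map_continuous
    line_inv_continuous.

Lemma line_chart_compatible : C1_compatible line_chart line_chart.
Proof.
have E : transition line_chart line_chart = idfun.
  by apply/funext => u; exact: line_invK.
suff: C1_transition line_chart line_chart by split.
move=> u _; rewrite E; split; first exact: ex_diff.
have -> : jacobian (idfun : 'rV[R]_1 -> 'rV[R]_1) = cst 1%:M.
  by apply/funext => v; exact: jacobian_id.
exact: cst_continuous.
Qed.

Lemma R_second_countable : @second_countable R.
Proof.
exists (range (fun q : rat * rat => `]ratr q.1 : R, ratr q.2[%classic)).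
  by apply: sub_countable (card_image_le _ _) _; exact: countableP.
split=> [_ [q _ <-]|x A].
  exact: interval_open.
move=> /nbhs_ballP[e /= e0 eA].
have [q /[!in_itv]/= /andP[xq qx]] : exists q, ratr q \in `]x - e, x[.
  by apply: rat_in_itvoo; rewrite ltrBlDr ltrDl.
have [r /[!in_itv]/= /andP[xr rx]] : exists q, ratr q \in `]x, x + e[.
  by apply: rat_in_itvoo; rewrite ltrDl.
exists `]ratr q : R, ratr r[%classic.
  by split; [exists (q, r)|rewrite /= in_itv/= qx xr].
move=> y /=; rewrite in_itv/= => /andP[qy yr]; apply: eA.
rewrite /ball /= ltr_distlC.
by rewrite (lt_trans xq qy) (lt_trans yr rx).
Qed.

Let line_cover (t : R) : exists2 c, [set line_chart] c & chart_dom c t.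
Proof. by exists line_chart. Qed.

Let line_compatible c d : [set line_chart] c -> [set line_chart] d ->
  C1_compatible c d.
Proof. by move=> -> ->; exact: line_chart_compatible. Qed.

Definition real_line : C1manifold R 1 :=
  manifold_of_atlas (@Rhausdorff R) R_second_countable
    line_cover line_compatible.

Lemma line_chart_atlas : @atlas R 1 real_line line_chart.
Proof. by move=> _ ->; exact: line_chart_compatible. Qed.

End real_line.
Arguments real_line R : clear implicits.
Arguments line_chart R : clear implicits.

Definition chart_at (R : realType) (m : nat) (M : C1manifold R m) (p : M) :=
  {c : chart R m M | atlas c /\ chart_dom c p}.

HB.instance Definition _ (R : realType) (m : nat) (M : C1manifold R m)
    (p : M) :=
  gen_eqMixin (chart_at p).
HB.instance Definition _ (R : realType) (m : nat) (M : C1manifold R m)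
    (p : M) :=
  gen_choiceMixin (chart_at p).

(* A tangent vector at p is a family of coordinate vectors, one for each chart
   c at p, that transforms by the differentials of the transition maps: the
   component at c is the image of the tangent vector under Dc(p). *)
Section tangent_space.
Context {R : realType} {m : nat} {M : C1manifold R m} (p : M).
Implicit Types c d : chart_at p.

Definition chart_at_val c : chart R m M := sval c.
Coercion chart_at_val : chart_at >-> chart.

Definition tangent_family : pred (chart_at p -> 'rV[R]_m) :=
  fun v => `[< forall c d,
    v d = v c *m jacobian (transition c d) (c p) >].

Let tangent_submod : submod_closed tangent_family.
Proof.
split=> [|a u v /asboolP uP /asboolP vP]; apply/asboolP => c d.
  by rewrite /= mul0mx.
by rewrite !fctE (uP c d) (vP c d) mulmxDl scalemxAl.
Qed.

HB.instance Definition _ :=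
  GRing.isSubmodClosed.Build R (chart_at p -> 'rV[R]_m) tangent_family
    tangent_submod.

Record tangent_space := TangentSpace {
  tangent_coord :> chart_at p -> 'rV[R]_m;
  tangent_coordP : tangent_coord \in tangent_family }.

HB.instance Definition _ := [isSub for tangent_coord].
HB.instance Definition _ := [Choice of tangent_space by <:].
HB.instance Definition _ := [SubChoice_isSubLmodule of tangent_space by <:].
HB.instance Definition _ := Topological.copy tangent_space
  (initial_topology (tangent_coord :
    tangent_space -> {ptws chart_at p -> 'rV[R]_m})).

Let of_coord_subproof c (u : 'rV[R]_m) :
  (fun d : chart_at p => u *m jacobian (transition c d) (c p))
    \in tangent_family.
Proof.
apply/asboolP => d e.
have [/= Ac cp] := svalP c; have [/= Ad dp] := svalP d.
have [/= Ae ep] := svalP e.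
rewrite -mulmxA; congr (_ *m _).
have [cd _] := atlas_compatible Ac Ad; have [de _] := atlas_compatible Ad Ae.
by have [_ ->] := transition_mx_comp cp ep dp cd de.
Qed.

(* The inverse of Dc(p). *)
Definition of_coord c (u : 'rV[R]_m) : tangent_space :=
  TangentSpace (of_coord_subproof c u).

Lemma of_coordK c u : of_coord c u c = u.
Proof.
have [_ cp] := svalP c.
have tr_id : \forall y \near c p, transition c c y = idfun y.
  have : \forall y \near c p, (c @` chart_dom c) y.
    by apply: open_nbhs_nbhs; split; [exact: chart_img_open|exists p].
  by apply: filterS => _ [q cq <-]; rewrite /transition /= chart_mapK.
have [_ E] := jacobian_near_eq tr_id (ex_diff (f := idfun)).
by rewrite /= E jacobian_id mulmx1.
Qed.

Lemma tangent_coordK c (v : tangent_space) : of_coord c (v c) = v.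
Proof.
apply/val_inj/funext => d /=.
by have /asboolP/(_ c d) := tangent_coordP v.
Qed.

End tangent_space.

(* Lin(T_x N, T_y M), with the topology of pointwise convergence; as the tangent
   spaces are finite-dimensional, this is the usual topology. *)
Section tangent_hom.
Context {R : realType} {n m : nat} {N : C1manifold R n} {M : C1manifold R m}.

Definition tangent_hom (x : N) (y : M) : Type :=
  {linear tangent_space x -> tangent_space y}.

Variables (x : N) (y : M).

HB.instance Definition _ := gen_eqMixin (tangent_hom x y).
HB.instance Definition _ := gen_choiceMixin (tangent_hom x y).
HB.instance Definition _ := Topological.copy (tangent_hom x y)
  (initial_topology ((fun A : tangent_hom x y => (A : _ -> _)) :
    tangent_hom x y -> {ptws tangent_space x -> tangent_space y})).

(* The matrix of Dpsi(y) \o A \o (Dphi(x))^-1. *)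
Definition hom_coord (phi : chart_at x) (psi : chart_at y)
    (A : tangent_hom x y) : 'M[R]_(n, m) :=
  lin1_mx (fun u => A (of_coord phi u) psi).

End tangent_hom.

Section line_hom.
Context {R : realType} {m : nat} {M : C1manifold R m}.

Definition line_chart_at (t : real_line R) : chart_at t :=
  exist _ (line_chart R) (conj line_chart_atlas I).

Variables (t : real_line R) (p : M) (v : tangent_space p).

Definition line_hom_fun (w : tangent_space t) : tangent_space p :=
  w (line_chart_at t) 0 0 *: v.

Lemma line_hom_is_linear : linear line_hom_fun.
Proof.
move=> a w w'; rewrite /line_hom_fun scalerA -scalerDl; congr (_ *: _).
by rewrite /= !fctE !mxE.
Qed.

HB.instance Definition _ :=
  GRing.isLinear.Build R (tangent_space t) (tangent_space p) _ line_hom_fun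
    line_hom_is_linear.

(* The identification of T_p M with Lin(T_t R, T_p M) = Lin(R, T_p M): v is sent
   to the linear map with value v at d/dt. *)
Definition line_hom : tangent_hom t p := line_hom_fun.

End line_hom.

Definition is_right_derivative (R : realType) (m : nat) (M : C1manifold R m)
    (f : R -> M) (t : R) (v : tangent_space (f t)) : Prop :=
  forall c : chart_at (f t),
    h^-1 *: (c (f (t + h)) - c (f t)) @[h --> 0^'+] --> v c.

Definition is_left_derivative (R : realType) (m : nat) (M : C1manifold R m)
    (f : R -> M) (t : R) (v : tangent_space (f t)) : Prop :=
  forall c : chart_at (f t),
    h^-1 *: (c (f (t + h)) - c (f t)) @[h --> 0^'-] --> v c.

Arguments is_right_derivative {R m M} f t v.
Arguments is_left_derivative {R m M} f t v.

Definition is_arc (R : realType) (T : topologicalType) (x y : T) (A : set T)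
    : Prop :=
  exists (a b : R) (g : R -> T),
    [/\ a <= b, {within `[a, b], continuous g}, g a = x, g b = y &
        A = g @` `[a, b]].
Arguments is_arc R {T} x y A.

Definition is_modulus (R : realType) (rho : R -> R) : Prop :=
  [/\ forall d, 0 <= d -> 0 <= rho d,
      forall d e, 0 <= d -> d <= e -> rho d <= rho e &
      rho d @[d --> 0^'+] --> 0].

(* edist_inf Lambda is +oo when Lambda is empty. *)
Definition is_QDQ (R : realType) (n m : nat) (F : 'rV[R]_n -> set 'rV[R]_m)
    (x : 'rV[R]_n) (y : 'rV[R]_m) (Lambda : set 'M[R]_(n, m))
    (Gamma : set 'rV[R]_n) : Prop :=
  compact Lambda /\
  exists (dstar : \bar R) (rho : R -> R),
    [/\ (0 < dstar)%E, is_modulus rho &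
      forall delta : R, 0 < delta -> (delta%:E < dstar)%E ->
      exists (L : 'rV[R]_n -> 'M[R]_(n, m)) (h : 'rV[R]_n -> 'rV[R]_m),
        {within ball x delta `&` Gamma, continuous (fun u => (L u, h u))} /\
        forall u, (ball x delta `&` Gamma) u ->
          [/\ (edist_inf Lambda (L u) <= (rho delta)%:E)%E,
              `|h u| <= delta * rho delta &
              F u (y + (u - x) *m L u + h u)]].

(* psi \o G \o phi^-1; its values off the image of phi are irrelevant to
   is_QDQ in the direction of a subset of that image. *)
Definition setmap_coord (R : realType) (n m : nat) (X Y : topologicalType)
    (phi : chart R n X) (psi : chart R m Y) (G : X -> set Y)
    : 'rV[R]_n -> set 'rV[R]_m :=
  fun u => psi @` (chart_dom psi `&` G (chart_inv phi u)).

(* The charts are meant to be centered: phi x = 0 and psi y = 0. *)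
Definition is_manifold_QDQ (R : realType) (n m : nat) (N : C1manifold R n)
    (M : C1manifold R m) (x : N) (y : M) (phi : chart_at x) (psi : chart_at y)
    (G : N -> set M) (Lambda : set (tangent_hom x y)) (Gamma : set N) : Prop :=
  compact Lambda /\
  is_QDQ (setmap_coord phi psi G) 0 0 (hom_coord phi psi @` Lambda)
    (phi @` (Gamma `&` chart_dom phi)).

(* Main.v *)
Require Import Defs.
From HB Require Import structures.
From mathcomp Require Import all_boot all_order all_algebra.
From mathcomp Require Import all_classical all_reals all_analysis.
From mathcomp Require Import ring lra.
Import Order.TTheory GRing.Theory Num.Theory.
Import numFieldNormedType.Exports.

Local Open Scope classical_set_scope.
Local Open Scope ring_scope.

(** Charts turn the statement into one about a curve [g : R -> R^m] with
    [g 0 = 0] that is continuous near [0] and whose slope [g x / x] tends to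
    [wr] as [x -> 0+] and to [wl] as [x -> 0-].  The coordinates of
    [line_hom t v] are [a * v psi], where [a] is the nonzero derivative at [0] of
    the inverse of the chart [phi] of the line ([hom_coord_line_hom],
    [chart_speed_neq0]); hence [(wr, wl)] is the pair of coordinates of the right
    and left derivatives when [a > 0], and the reversed pair when [a < 0]
    ([slopes_in_charts]).

    An arc in [Lambda] gives a QDQ ([QDQ_of_path]): reparametrize it as a path
    [p] that stays at [wr] after [1] and at [wl] before [-1], and take
    [L_delta x := p (x / delta^2)].  This takes values in [Lambda], and the
    remainder [g x - x L_delta x] is small for two different reasons: outside
    [|x| < delta^2] the path has reached the one-sided derivative, so that the
    remainder is [o(x)]; inside, it differs from [o(x)] by at most
    [delta^2] times twice a bound of [Lambda], which is [o(delta)].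

    Conversely ([connected_of_QDQ]), let [S_delta] be the image of the
    [delta]-ball under [L_delta].  It is connected, it lies in a
    [rho delta]-neighbourhood of [Lambda], and, since [L_delta x] is [g x / x]
    up to [2 rho delta] at [x = delta / 2] and [x = - delta / 2], it contains
    points that converge to [wr] and to [wl].  The upper limit of the [S_delta]
    as [delta -> 0+] is the required set: an upper limit of connected sets that
    accumulate only on a compact set, and that contain a convergent choice of
    points, is connected ([limsup_set_connected]).  It is brought back to linear
    maps between tangent spaces by the continuous inverse of the coordinate map
    ([hom_coordK], [hom_of_coord_continuous]). *)

(** * Upper limits of connected sets *)

(** The Kuratowski upper limit: the points each of whose neighbourhoods meets
    [S i] for [F]-frequently many [i]. *)
Definition limsup_set {I : Type} {X : topologicalType} (F : set_system I)
    (S : I -> set X) : set X :=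
  \bigcap_(D in F) closure (\bigcup_(i in D) S i).

Lemma limsup_set_closed {I : Type} {X : topologicalType} (F : set_system I)
    (S : I -> set X) : closed (limsup_set F S).
Proof. by apply: closed_bigI => D _; exact: closed_closure. Qed.

Lemma cvg_limsup_set {I : Type} {X : topologicalType} {F : set_system I}
    {FF : ProperFilter F} {S : I -> set X} {p : I -> X} {x : X} :
  (\forall i \near F, S i (p i)) -> p @ F --> x -> limsup_set F S x.
Proof.
move=> Sp px D FD V Vx.
have [i [[Di Si] Vi]] := filter_ex (filterI (filterI FD Sp) (px _ Vx)).
by exists (p i); split=> //; exists i.
Qed.

Section limsup_compact.
Context {R : realType} {I : Type} {X : pseudoMetricType R}.
Context {F : set_system I} {FF : ProperFilter F}.
Context {S : I -> set X} {Lambda : set X}.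
Hypothesis compactL : compact Lambda.
Hypothesis closedL : closed Lambda.
Hypothesis SL : forall e : R, 0 < e ->
  \forall i \near F, S i `<=` \bigcup_(x in Lambda) ball x e.

Lemma limsup_set_sub : limsup_set F S `<=` Lambda.
Proof.
move=> z Cz; apply: closedL => V /nbhs_ballP[e /= e0 eV].
have e20 : 0 < e / 2 by rewrite divr_gt0.
have [y [[i SiL Siy] yz]] := Cz _ (SL _ e20) _ (nbhsx_ballx z _ e20).
have [x Lx xy] := SiL _ Siy.
exists x; split=> //; apply: eV.
by rewrite [e]splitr; apply: ball_triangle yz (ball_sym xy).
Qed.

(** A compactness argument over [Lambda]: near a point of [Lambda] that is in the
    upper limit, [W] is a neighbourhood; near any other point, the sets [S i]
    are eventually absent.  By compactness one radius and one tail of [F] serve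
    all the points of [Lambda], and [S i] is eventually covered by balls of
    that radius. *)
Lemma limsup_set_near (W : set X) : open W -> limsup_set F S `<=` W ->
  \forall i \near F, S i `<=` W.
Proof.
move=> oW CW.
have cov : \forall e \near (0 : R)^'+ & i \near F,
    Lambda `<=` [set x | ball x e `&` S i `<=` W].
  have /compact_near_coveringP := compactL.
  move=> /(_ _ (filter_prod (0 : R)^'+ F)
    (fun ei x => ball x ei.1 `&` S ei.2 `<=` W)) /= H.
  apply: H => x _.
  have [Wx|nWx] := pselect (W x).
    have /nbhs_ballP[e /= e0 eW] : nbhs x W by apply: open_nbhs_nbhs.
    have e20 : 0 < e / 2 by rewrite divr_gt0.
    exists (ball x (e / 2), [set ei | ei.1 < e / 2]) => /=.
      split; first exact: nbhsx_ballx.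
      exists ([set d | d < e / 2], setT) => //=; last by move=> [d i] [].
      by split; [exact: nbhs_right_lt|exact: filterT].
    move=> [y [d i]] /= [xy de] z [yz _]; apply: eW.
    rewrite [e]splitr; apply: ball_triangle xy _.
    exact: le_ball (ltW de) _ yz.
  have /existsNP[D /not_implyP[FD]] : ~ limsup_set F S x by move=> /CW.
  move=> /existsNP[V /not_implyP[/nbhs_ballP[e /= e0 eV] SV]].
  have e20 : 0 < e / 2 by rewrite divr_gt0.
  exists (ball x (e / 2), [set ei | ei.1 < e / 2 /\ D ei.2]) => /=.
    split; first exact: nbhsx_ballx.
    exists ([set d | d < e / 2], D) => //=.
    split=> //; exact: nbhs_right_lt.
  move=> [y [d i]] /= [xy [de Di]] z [yz Siz]; exfalso; apply: SV.
  exists z; split; first by exists i.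
  apply: eV; rewrite [e]splitr; apply: ball_triangle xy _.
  exact: le_ball (ltW de) _ yz.
have [[A B] /= [A0 FB] AB] := cov.
have [e [e0 Ae]] := filter_ex (filterI (nbhs_right_gt 0) A0).
apply: filterS (filterI FB (SL _ e0)) => i [Bi SiL] y Siy.
have [x Lx xy] := SiL _ Siy.
by apply: (AB (e, i)) Lx _ _.
Qed.

(** If the upper limit were the union of two disjoint nonempty closed sets,
    disjoint open neighbourhoods [U] and [V] of them would eventually cover
    [S i]; being connected and containing [p i], which is in the neighbourhood
    [U] of the part of [x], [S i] would lie in [U], and the part in [V] could not
    be accumulated. *)
Lemma limsup_set_connected {p : I -> X} {x : X} :
  (\forall i \near F, connected (S i)) ->
  (\forall i \near F, S i (p i)) -> p @ F --> x ->
  connected (limsup_set F S).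
Proof.
move=> cS Sp px; set C := limsup_set F S.
have Cx : C x := cvg_limsup_set Sp px.
apply: contrapT => /connectedPn[E [E0 CE sE]].
wlog Ex : E E0 CE sE / E false x.
  move=> wl; have := Cx; rewrite CE => -[|].
    exact: (wl E).
  by apply: (wl (E \o negb)) => //=; [rewrite CE setUC|rewrite separatedC].
have cC : closed C := limsup_set_closed _ _.
have sub b : E b `<=` C by move=> y Ey; rewrite CE; case: b Ey; [right|left].
have cE b : closed (E b).
  move=> y Ey; have := cC _ (closureS (sub b) Ey); rewrite CE => -[] Ey'.
    by case: b Ey => // Ey; case: sE => _ /disjoints_subset/(_ _ Ey').
  by case: b Ey => // Ey; case: sE => /disjoints_subset/(_ _ Ey).
have [U [V [oU oV EU EV UV]]] := (@normal_openP R X).1 pseudometric_normal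
  _ _ (cE false) (cE true) (separated_disjoint sE).
have UVsep : separated U V.
  split; apply/disjoints_subset.
    move=> y Uy Vy; have [z []] := Uy V (open_nbhs_nbhs (conj oV Vy)).
    by move: UV => /disjoints_subset; exact.
  move=> y Uy Vy; have [z []] := Vy U (open_nbhs_nbhs (conj oU Uy)).
  by move=> Vz Uz; move: UV => /disjoints_subset/(_ _ Uz).
have SUV : \forall i \near F, S i `<=` U `|` V.
  apply: limsup_set_near; first exact: openU.
  by rewrite -/C CE; exact: setUSS.
have SU : \forall i \near F, S i `<=` U.
  have pU : \forall i \near F, U (p i).
    by apply: px; apply: open_nbhs_nbhs; split=> //; exact: EU.
  near=> i.
  have Si : S i `<=` U \/ S i `<=` V.
    by apply: (connected_subset UVsep); near: i.
  have Up : U (p i) by near: i.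
  case: Si => // SV; exfalso.
  have Vp : V (p i) by apply: SV; near: i.
  by move: UV => /disjoints_subset/(_ _ Up).
have [y Ey] := E0 true.
have [z [[i SiU Siz] Vz]] :
    (\bigcup_(i in [set i | S i `<=` U]) S i `&` V) !=set0.
  apply: (sub _ _ Ey _ SU); apply: open_nbhs_nbhs; split=> //; exact: EV.
by move: UV => /disjoints_subset/(_ _ (SiU _ Siz)).
Unshelve. all: by end_near. Qed.

End limsup_compact.

(** * Curves in Euclidean space with one-sided slopes *)

Lemma cvg_at_right0 {R : realType} {T : Type} {F : set_system T}
    {FF : Filter F} (s : T -> R) :
  s @ F --> 0 -> (\forall x \near F, 0 < s x) -> s @ F --> 0^'+.
Proof.
move=> s0 sp U U0; change (\forall x \near F, U (s x)).
have : \forall x \near F, 0 < s x -> U (s x) := s0 _ U0.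
by apply: filterS2 sp => x sx; exact.
Qed.

Lemma cvg_at_left0 {R : realType} {T : Type} {F : set_system T}
    {FF : Filter F} (s : T -> R) :
  s @ F --> 0 -> (\forall x \near F, s x < 0) -> s @ F --> 0^'-.
Proof.
move=> s0 sn U U0; change (\forall x \near F, U (s x)).
have : \forall x \near F, s x < 0 -> U (s x) := s0 _ U0.
by apply: filterS2 sn => x sx; exact.
Qed.

(** The arc is run through backwards on [-1, 1] and prolonged by its endpoints. *)
Lemma arc_path {R : realType} {T : topologicalType} {x y : T} {A : set T} :
  is_arc R x y A -> exists p : R -> T,
    [/\ continuous p, forall s, A (p s), forall s, 1 <= s -> p s = x &
        forall s, s <= -1 -> p s = y].
Proof.
move=> [a [b [g [ab cg ga gb ->]]]].
(* tau is a on [1, +oo) and b on (-oo, -1]. *)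
pose tau (s : R) := a + (b - a) * ((1 - Num.max (-1) (Num.min s 1)) / 2).
have ctau : continuous tau.
  move=> s; apply: cvgD; first exact: cvg_cst.
  apply: cvgM; first exact: cvg_cst.
  apply: cvgM; last exact: cvg_cst.
  apply: cvgB; first exact: cvg_cst.
  apply: (@continuous_max R R (cst (-1)) (fun s => Num.min s 1)).
    exact: cvg_cst.
  by apply: (@continuous_min R R id (cst 1)); [exact: cvg_id|exact: cvg_cst].
have tauab s : `[a, b]%classic (tau s).
  rewrite /= in_itv /=; apply/andP; split.
    rewrite lerDl mulr_ge0 ?subr_ge0// divr_ge0// subr_ge0.
    by rewrite ge_max ge_min lexx orbT andbT; lra.
  rewrite -lerBrDl ler_piMr ?subr_ge0// ler_pdivrMr// mul1r.
  by rewrite lerBlDr -lerBlDl le_max; apply/orP; left; lra.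
exists (g \o tau); split.
- move=> s; apply: (cvg_comp tau g _ ((subspace_continuousP _ _).1 cg _ _)).
    move=> U HU; change (\forall z \near s, U (tau z)).
    have : \forall z \near s, `[a, b]%classic (tau z) -> U (tau z) := ctau s _ HU.
    by apply: filterS => z; apply; exact: tauab.
  exact: tauab.
- by move=> s; exists (tau s) => //; apply: tauab.
- move=> s s1; rewrite /= /tau min_r// max_r; last by lra.
  by rewrite subrr mul0r mulr0 addr0.
- move=> s s1; rewrite /= /tau min_l; last by lra.
  by rewrite max_l// opprK -[1 + 1]/(2%:R) divff ?pnatr_eq0// mulr1 subrKC.
Qed.

(** The supremum of [|e|] over the punctured ball of radius [d] would do, but it
    may be infinite for large [d]; truncating [|e|] at [1] makes it a modulus on
    the whole half-line without changing it for small [d]. *)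
Lemma ex_modulus {R : realType} (e : R -> R) : e x @[x --> 0^'] --> (0 : R) ->
  exists omega : R -> R, is_modulus omega /\
    exists2 r, 0 < r & forall d x, d < r -> x != 0 -> `|x| <= d ->
      `|e x| <= omega d.
Proof.
move=> /cvgrPdist_lt e0.
pose E d := 0 |` [set Num.min `|e x| 1 | x in [set x | x != 0 /\ `|x| <= d]].
have near0 (eps : R) : 0 < eps -> exists2 r, 0 < r &
    forall x, x != 0 -> `|x| < r -> `|e x| < eps.
  move=> eps0; have /nbhs_ballP[r /= r0 re] := e0 _ eps0.
  exists r => // x x0 xr; rewrite -normrN -sub0r; apply: re => //.
  by rewrite /ball /= sub0r normrN.
have Eub d : has_ubound (E d).
  by exists 1 => _ [->//|[x _ <-]]; rewrite ge_min lexx orbT.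
have E0 d : E d 0 by left.
exists (sup \o E); split; first split.
- by move=> d _; apply: ub_le_sup.
- move=> d d' _ dd'; apply: ge_sup; first by exists 0.
  move=> _ [->|[x [x0 xd] <-]]; apply: ub_le_sup => //.
  by right; exists x => //; split=> //; exact: le_trans dd'.
- apply/cvgrPdist_le => eps eps0; have [r r0 re] := near0 _ eps0.
  near=> d.
  rewrite sub0r normrN ger0_norm; last exact: ub_le_sup.
  apply: ge_sup; first by exists 0.
  move=> _ [->|[x [x0 xd] <-]]; first exact: ltW.
  rewrite ge_min ltW//; apply: re => //; apply: le_lt_trans xd _.
  by near: d; exact: nbhs_right_lt.
have [r r0 re] := near0 _ ltr01.
exists r => // d x dr x0 xd; apply: ub_le_sup => //; right.
exists x => //; rewrite min_l// ltW//; apply: re => //.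
exact: le_lt_trans dr.
Unshelve. all: by end_near. Qed.

Lemma mulmx_row1 {R : realType} {m} (u : 'rV[R]_1) (L : 'M[R]_(1, m)) :
  u *m L = u 0 0 *: L.
Proof. by rewrite {1}[u]mx11_scalar mul_scalar_mx. Qed.

Lemma ball_rV1 {R : realType} (d : R) (u : 'rV[R]_1) :
  ball 0 d u <-> `|u 0 0| < d.
Proof.
split=> [[_ /(_ 0 0)]|ud]; first by rewrite /ball /= mxE sub0r normrN.
split; first exact: le_lt_trans ud.
by move=> i j; rewrite !ord1 /ball /= mxE sub0r normrN.
Qed.

Lemma const_mx_continuous {R : realType} {n m} :
  continuous (fun x : R => const_mx x : 'M[R]_(n, m)).
Proof.
move=> x; apply: cvg_mx => i j; rewrite mxE.
by under eq_cvg do rewrite mxE; exact: cvg_id.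
Qed.

Lemma connected_ball_rV1 {R : realType} (d : R) :
  connected (ball (0 : 'rV[R]_1) d).
Proof.
rewrite (_ : ball _ _ = (fun x => const_mx x) @` `]-d, d[); last first.
  apply/seteqP; split=> [u /ball_rV1 ud|_ [x xd <-]].
    exists (u 0 0); first by rewrite /= in_itv/= -ltr_norml.
    by apply/rowP => j; rewrite mxE ord1.
  by apply/ball_rV1; rewrite mxE ltr_norml; move: xd; rewrite /= in_itv.
apply: connected_continuous_connected.
  exact/connected_intervalP/interval_is_interval.
by apply: continuous_subspaceT; exact: const_mx_continuous.
Qed.

Section one_variable.
Context {R : realType} {m : nat}.
Variables (g : R -> 'rV[R]_m) (wl wr : 'rV[R]_m).
Hypothesis g0 : g 0 = 0.
Hypothesis gr : x^-1 *: g x @[x --> 0^'+] --> wr.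
Hypothesis gl : x^-1 *: g x @[x --> 0^'-] --> wl.

Lemma slope_modulus : exists omega : R -> R, is_modulus omega /\
  exists2 r, 0 < r & forall d x, d < r -> x != 0 -> `|x| <= d ->
    `|x^-1 *: g x - if 0 < x then wr else wl| <= omega d.
Proof.
pose e x := `|x^-1 *: g x - if 0 < x then wr else wl|.
have e0 : e x @[x --> 0^'] --> (0 : R).
  apply: (@cvg_at_right_left_dnbhs R R^o e).
    have : `|x^-1 *: g x - wr| @[x --> 0^'+] --> `|wr - wr|.
      by apply: cvg_norm; apply: cvgB gr (cvg_cst _).
    rewrite subrr normr0; apply: cvg_trans; apply: near_eq_cvg; near=> x.
    by rewrite /e ifT//.
  have : `|x^-1 *: g x - wl| @[x --> 0^'-] --> `|wl - wl|.
    by apply: cvg_norm; apply: cvgB gl (cvg_cst _).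
  rewrite subrr normr0; apply: cvg_trans; apply: near_eq_cvg; near=> x.
  by rewrite /e ifF//; apply/negbTE; rewrite -leNgt ltW.
have [omega [momega [r r0 eo]]] := ex_modulus e e0.
exists omega; split=> //; exists r => // d x dr x0 xd.
by have := eo d x dr x0 xd; rewrite normr_id.
Unshelve. all: by end_near. Qed.

Variables (F : 'rV[R]_1 -> set 'rV[R]_m) (Gamma : set 'rV[R]_1).
Variables (Lambda : set 'M[R]_(1, m)) (r : R).
Hypothesis r0 : 0 < r.

(** With [w] the one-sided derivative on the side of [x], the remainder
    [g x - x L_delta x] is the sum of [x (g x / x - w)] and
    [x (w - p (x / delta^2))]; the first is bounded by the modulus of the slope,
    the second vanishes unless [|x| < delta^2]. *)
Lemma QDQ_of_path (p : R -> 'M[R]_(1, m)) :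
  (forall x, `|x| < r -> {for x, continuous g}) ->
  (forall u, ball 0 r u -> F u (g (u 0 0))) ->
  compact Lambda -> continuous p -> (forall s, Lambda (p s)) ->
  (forall s, 1 <= s -> p s = wr) -> (forall s, s <= -1 -> p s = wl) ->
  is_QDQ F 0 0 Lambda Gamma.
Proof.
move=> cg Fg cL cp pL pr pl; split=> //.
have [omega [[omega0 omega_le omega_cvg] [r1 r10 gomega]]] := slope_modulus.
have [K K0 LK] : exists2 K, 0 <= K & forall A, Lambda A -> `|A| <= K.
  have [M [_ LM]] := compact_bounded cL.
  exists (Num.max 0 (M + 1)); first by rewrite le_max lexx.
  move=> A LA; apply: le_trans (LM (M + 1) _ _ LA) _; first by rewrite ltrDl.
  by rewrite le_max lexx orbT.
(* K bounds Lambda; 2 K d bounds the second term divided by d. *)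
exists (Num.min r r1)%:E, (fun d => omega d + 2 * K * d); split.
- by rewrite lte_fin lt_min r0.
- split=> [d d0|d d' d0 dd'|].
  + by rewrite addr_ge0 ?omega0// !mulr_ge0.
  + by rewrite lerD ?omega_le// ler_wpM2l// mulr_ge0.
  + rewrite -[X in _ --> X]addr0; apply: cvgD => //.
    rewrite -[X in _ --> X](mulr0 (2 * K)); apply: cvgM; first exact: cvg_cst.
    exact: cvg_within.
move=> d d0; rewrite lte_fin lt_min => /andP[dr dr1].
exists (fun u => p (u 0 0 / d ^+ 2)).
exists (fun u => g (u 0 0) - u 0 0 *: p (u 0 0 / d ^+ 2)).
have c00 : continuous (fun v : 'rV[R]_1 => v 0 0) by exact: coord_continuous.
pose Lh x := (p (x / d ^+ 2), g x - x *: p (x / d ^+ 2)).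
have cLh x : `|x| < r -> {for x, continuous Lh}.
  move=> xr; have cpx : p (y / d ^+ 2) @[y --> x] --> p (x / d ^+ 2).
    apply: (cvg_comp (fun y => y / d ^+ 2) p _ (cp _)).
    by apply: cvgM; [exact: cvg_id|exact: cvg_cst].
  have ghx : g y - y *: p (y / d ^+ 2) @[y --> x] --> g x - x *: p (x / d ^+ 2).
    by apply: cvgB; [exact: cg|apply: cvgZ; [exact: cvg_id|exact: cpx]].
  exact: (cvg_pair cpx ghx).
split.
  apply: continuous_in_subspaceT => u /set_mem[/ball_rV1 ud _].
  apply: (cvg_comp (fun v : 'rV[R]_1 => v 0 0) Lh (c00 u)).
  exact/cLh/(lt_trans ud).
move=> u [ud _]; split.
- rewrite edist_inf0// lee_fin addr_ge0 ?omega0 ?(ltW d0)//.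
  by rewrite !mulr_ge0// ltW.
- move/ball_rV1: ud; move: (u 0 0) => x xd.
  have [->|x0] := eqVneq x 0.
    rewrite g0 scale0r subrr normr0 mulr_ge0 ?addr_ge0 ?omega0 ?mulr_ge0//;
    exact: ltW.
  set w := if 0 < x then wr else wl.
  have xw : `|x *: (x^-1 *: g x - w)| <= d * omega d.
    rewrite normrZ ler_pM// ?(ltW xd)//.
    by apply: gomega => //; exact: ltW.
  have wL : Lambda w.
    rewrite /w; case: ifP => _; [rewrite -(pr 1)//|rewrite -(pl (-1))//].
  have wp : `|x *: (w - p (x / d ^+ 2))| <= d * (2 * K * d).
    have [xd2|xd2] := ltP `|x| (d ^+ 2).
      rewrite normrZ [X in _ <= X](_ : _ = d ^+ 2 * (2 * K)); last by ring.
      rewrite ler_pM ?(ltW xd2)//.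
      rewrite (le_trans (ler_normB _ _))// mulr_natl mulr2n.
      by rewrite lerD// LK.
    rewrite [w](_ : _ = p (x / d ^+ 2)).
      by rewrite subrr scaler0 normr0 !mulr_ge0// ltW.
    rewrite /w; case: ifPn => [xp|]; first rewrite pr//.
      by rewrite ler_pdivlMr ?exprn_gt0// mul1r -(gtr0_norm xp).
    rewrite -leNgt => xn; rewrite pl//.
    rewrite ler_pdivrMr ?exprn_gt0// mulN1r lerNr.
    by rewrite -(ler0_norm xn).
  rewrite mulrDr; apply: le_trans (lerD xw wp).
  apply: le_trans (ler_normD _ _); rewrite -scalerDr addrA subrK scalerBr.
  by rewrite scalerA divff// scale1r.
- rewrite subr0 add0r mulmx_row1 addrC subrK.
  by apply: Fg; exact: le_ball (ltW dr) _ ud.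
Qed.

(** The set is the upper limit of the images [S_delta] of the [delta]-balls under
    [L_delta]. *)
Lemma connected_of_QDQ :
  (forall u, ball 0 r u -> F u `<=` [set g (u 0 0)]) ->
  ball 0 r `<=` Gamma -> is_QDQ F 0 0 Lambda Gamma ->
  exists C, [/\ connected C, C `<=` Lambda, C wr & C wl].
Proof.
move=> Fg rG [cL [dstar [rho [dstar0 [_ _ rho0] H]]]].
have {H}/choice[LH LHP] d : exists LH :
    ('rV[R]_1 -> 'M[R]_(1, m)) * ('rV[R]_1 -> 'rV[R]_m),
    0 < d -> (d%:E < dstar)%E -> d <= r ->
    {within ball 0 d, continuous LH.1} /\
    forall u, ball 0 d u -> [/\ (edist_inf Lambda (LH.1 u) <= (rho d)%:E)%E,
      `|LH.2 u| <= d * rho d & g (u 0 0) = u 0 0 *: LH.1 u + LH.2 u].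
  have [d0|] := pselect (0 < d); last by exists (cst 0, cst 0).
  have [dd|] := pselect (d%:E < dstar)%E; last by exists (cst 0, cst 0).
  have [L [h [cLh Lh]]] := H d d0 dd.
  exists (L, h) => _ _ dr.
  have rI : ball 0 d `&` Gamma = ball 0 d.
    by apply/setIidl => u ud; apply: rG; exact: le_ball dr _ ud.
  rewrite rI in cLh Lh; split.
    move=> u; apply: (cvg_comp (fun u => (L u, h u)) fst); first exact: cLh.
    exact: cvg_fst.
  move=> u ud; have [? ? Fu] := Lh u ud; split=> //.
  rewrite -(Fg _ _ _ Fu) ?subr0 ?add0r ?mulmx_row1//.
  exact: le_ball dr _ ud.
pose S d := (LH d).1 @` ball 0 d.
have good : \forall d \near (0 : R)^'+, [/\ 0 < d, (d%:E < dstar)%E & d <= r].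
  near=> d; split; [by []| |by near: d; exact: nbhs_right_le].
  near: d; case: dstar dstar0 {LHP} => [s|_|//].
    rewrite lte_fin => s0; near=> d; rewrite lte_fin.
    by near: d; exact: nbhs_right_lt.
  by near=> d; rewrite ltry.
have SL (e : R) : 0 < e ->
    \forall d \near (0 : R)^'+, S d `<=` \bigcup_(x in Lambda) ball x e.
  move=> e0.
  near=> d => _ [u ud <-].
  have [d0 dd dr] : [/\ 0 < d, (d%:E < dstar)%E & d <= r] by near: d.
  have [_ /(_ u ud)[Lu _ _]] := LHP d d0 dd dr.
  have : (edist_inf Lambda ((LH d).1 u) < e%:E)%E.
    apply: le_lt_trans Lu _; rewrite lte_fin.
    near: d; have /cvgrPdist_lt/(_ _ e0) := rho0; apply: filterS => d.
    by rewrite sub0r normrN; apply: le_lt_trans; exact: ler_norm.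
  move=> /ereal_inf_lt[_ [x Lx <-] /edist_lt_ball /= xe].
  by exists x => //; exact: ball_sym.
have closedL : closed Lambda by apply: compact_closed => //; exact: norm_hausdorff.
have conS : \forall d \near (0 : R)^'+, connected (S d).
  near=> d; have [d0 dd dr] : [/\ 0 < d, (d%:E < dstar)%E & d <= r] by near: d.
  have [cLd _] := LHP d d0 dd dr.
  exact: connected_continuous_connected (connected_ball_rV1 d) cLd.
(* The point c * d, with c = 1 / 2 or c = - 1 / 2, is well inside the ball of
   radius d, but far enough from 0 for h_d / (c * d) to be at most 2 * rho d. *)
have main (c : R) (w : 'rV[R]_m) : `|c| = 1 / 2 ->
    (c * d)^-1 *: g (c * d) @[d --> 0^'+] --> w ->
    exists p, (\forall d \near (0 : R)^'+, S d (p d)) /\ p @ (0 : R)^'+ --> w.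
  move=> c12 gc; exists (fun d => (LH d).1 (const_mx (c * d))); split.
    near=> d; exists (const_mx (c * d)) => //.
    have d0 : 0 < d by [].
    by apply/ball_rV1; rewrite mxE normrM c12 gtr0_norm//; lra.
  apply/cvgrPdist_lt => e e0.
  have e20 : 0 < e / 2 by rewrite divr_gt0.
  have e40 : 0 < e / 4 by rewrite divr_gt0.
  near=> d; have [d0 dd dr] : [/\ 0 < d, (d%:E < dstar)%E & d <= r] by near: d.
  have cd : `|c * d| = d / 2 by rewrite normrM c12 gtr0_norm// mulrC mul1r.
  have cd0 : c * d != 0 by rewrite -normr_gt0 cd divr_gt0.
  have [_ /(_ (const_mx (c * d)))[|_ hd]] := LHP d d0 dd dr.
    by apply/ball_rV1; rewrite mxE cd; lra.
  rewrite mxE => gE.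
  have gw : `|w - (c * d)^-1 *: g (c * d)| < e / 2.
    by near: d; move/cvgrPdist_lt: gc; apply.
  have rd : rho d < e / 4.
    near: d; have /cvgrPdist_lt/(_ _ e40) := rho0; apply: filterS => d.
    by rewrite sub0r normrN; apply: le_lt_trans; exact: ler_norm.
  have hs : `|(c * d)^-1 *: (LH d).2 (const_mx (c * d))| < e / 2.
    rewrite normrZ normfV cd invf_div.
    apply: (@le_lt_trans _ _ (2 / d * (d * rho d))).
      by rewrite ler_wpM2l// divr_ge0// ltW.
    by rewrite mulrA divfK ?gt_eqF//; lra.
  have -> : (LH d).1 (const_mx (c * d)) = (c * d)^-1 *: g (c * d) -
      (c * d)^-1 *: (LH d).2 (const_mx (c * d)).
    by rewrite gE scalerDr scalerA mulVf// scale1r addrK.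
  rewrite opprB addrCA [e]splitr addrC; apply: le_lt_trans (ler_normD _ _) _.
  exact: ltrD.
have [pr [Spr prw]] : exists p, (\forall d \near (0 : R)^'+, S d (p d)) /\
    p @ (0 : R)^'+ --> wr.
  apply: (main (1 / 2)); first by rewrite ger0_norm.
  apply: (cvg_comp (fun d => 1 / 2 * d) (fun x => x^-1 *: g x) _ gr).
  apply: cvg_at_right0; last by near=> d; rewrite mulr_gt0.
  rewrite -[X in _ --> X](mulr0 (1 / 2)); apply: cvgM; first exact: cvg_cst.
  exact: cvg_within.
have [pl [Spl plw]] : exists p, (\forall d \near (0 : R)^'+, S d (p d)) /\
    p @ (0 : R)^'+ --> wl.
  apply: (main (- (1 / 2))); first by rewrite normrN ger0_norm.
  apply: (cvg_comp (fun d => - (1 / 2) * d) (fun x => x^-1 *: g x) _ gl).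
  apply: cvg_at_left0; last by near=> d; rewrite mulNr oppr_lt0 mulr_gt0.
  rewrite -[X in _ --> X](mulr0 (- (1 / 2))); apply: cvgM; first exact: cvg_cst.
  exact: cvg_within.
exists (limsup_set (0 : R)^'+ S); split.
- have := limsup_set_connected cL SL conS Spr prw; exact.
- exact: limsup_set_sub.
- have := cvg_limsup_set Spr prw; exact.
- have := cvg_limsup_set Spl plw; exact.
Unshelve. all: by end_near. Qed.

End one_variable.

(** * Coordinates on spaces of tangent vectors and of linear maps *)

Lemma continuous_ptws {I : choiceType} {X V : topologicalType}
    (f : X -> {ptws I -> V}) :
  (forall i, continuous (fun x => f x i)) -> continuous f.
Proof.
move=> cf x; apply/cvg_sup => i.
exact: (@continuous_comp_initial {ptws I -> V} X V (fun g => g i) f (cf i)).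
Qed.

Section tangent.
Context {R : realType} {m : nat} {M : C1manifold R m}.

Lemma tangent_coord_inj {p : M} (c : chart_at p) (v w : tangent_space p) :
  v c = w c -> v = w.
Proof. by move=> vw; rewrite -(tangent_coordK c v) vw tangent_coordK. Qed.

Lemma tangent_coordZ {p : M} (c : chart_at p) (a : R) (v : tangent_space p) :
  (a *: v) c = a *: v c.
Proof. by []. Qed.

Lemma tangent_coord_continuous {p : M} (c : chart_at p) :
  continuous (fun v : tangent_space p => v c).
Proof.
move=> v; apply: (@continuous_comp _ {ptws chart_at p -> 'rV[R]_m} _
  (@tangent_coord R m M p) (fun g => g c) v).
  exact: (@initial_continuous (tangent_space p)
    {ptws chart_at p -> 'rV[R]_m} (@tangent_coord R m M p)).
exact: (@proj_continuous (chart_at p) (fun _ => 'rV[R]_m) c).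
Qed.

Lemma tangent_continuous {T : topologicalType} {p : M}
    (f : T -> tangent_space p) :
  (forall c, continuous (fun x => f x c)) -> continuous f.
Proof.
move=> cf; apply: (@continuous_comp_initial (tangent_space p) T
  {ptws chart_at p -> 'rV[R]_m} (@tangent_coord R m M p) f).
by apply: continuous_ptws.
Qed.

Lemma tangent_hom_eq {n : nat} {N : C1manifold R n} {x : N} {y : M}
    (A B : tangent_hom x y) : A =1 B -> A = B.
Proof.
rewrite /tangent_hom in A B *; move: A B => [A cA] [B cB] /= /funext AB.
rewrite {}AB in cA *; congr (GRing.Linear.Pack _).
case: cA cB => [[a1] [a2]] [[b1] [b2]].
by f_equal; f_equal; exact: Prop_irrelevance.
Qed.

Lemma tangent_hom_eval_continuous {n : nat} {N : C1manifold R n} {x : N} {y : M}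
    (v : tangent_space x) : continuous (fun A : tangent_hom x y => A v).
Proof.
move=> A; apply: (@continuous_comp _ {ptws tangent_space x -> tangent_space y} _
  (fun B : tangent_hom x y => (B : _ -> _)) (fun g => g v) A).
  exact: (@initial_continuous (tangent_hom x y)
    {ptws tangent_space x -> tangent_space y} (fun B => (B : _ -> _))).
exact: (@proj_continuous (tangent_space x) (fun _ => tangent_space y) v).
Qed.

Lemma tangent_hom_continuous {T : topologicalType} {n : nat}
    {N : C1manifold R n} {x : N} {y : M} (f : T -> tangent_hom x y) :
  (forall v, continuous (fun s => f s v)) -> continuous f.
Proof.
move=> cf; apply: (@continuous_comp_initial (tangent_hom x y) T
  {ptws tangent_space x -> tangent_space y} (fun A => (A : _ -> _)) f).
by apply: continuous_ptws.
Qed.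

End tangent.

Section line_hom_coordinates.
Context {R : realType} {m : nat} {M : C1manifold R m}.
Context {t : real_line R} {p : M} (phi : chart_at t) (psi : chart_at p).

(** The tangent vector d/dt of the line at [t]. *)
Definition unit_tangent : tangent_space t :=
  of_coord (line_chart_at t) (const_mx 1).

(** The derivative at [phi t] of the inverse of [phi], read as a curve in the
    line. *)
Definition chart_speed : R :=
  jacobian (transition phi (line_chart R)) (phi t) 0 0.

Lemma line_homE (A : tangent_hom t p) : A = line_hom t (A unit_tangent).
Proof.
apply: tangent_hom_eq => w; rewrite /line_hom /= /line_hom_fun -linearZ; congr (A _).
apply: (tangent_coord_inj (line_chart_at t)).
rewrite tangent_coordZ of_coordK; apply/rowP => j.
by rewrite !mxE mulr1 ord1.
Qed.

Lemma line_hom_unit (v : tangent_space p) : line_hom t v unit_tangent = v.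
Proof.
rewrite /line_hom /= /line_hom_fun.
by rewrite [unit_tangent _]of_coordK mxE scale1r.
Qed.

Lemma hom_coordE (A : tangent_hom t p) :
  hom_coord phi psi A = chart_speed *: A unit_tangent psi.
Proof.
have E : of_coord phi (delta_mx 0 0) = chart_speed *: unit_tangent.
  apply: (tangent_coord_inj (line_chart_at t)).
  rewrite tangent_coordZ of_coordK /= -rowE; apply/rowP => j.
  by rewrite ord1 mxE [RHS]mxE [X in _ * X]mxE mulr1.
apply/matrixP => i j; rewrite !ord1 /hom_coord /lin1_mx !mxE E linearZ.
by rewrite tangent_coordZ mxE.
Qed.

Lemma hom_coord_line_hom v :
  hom_coord phi psi (line_hom t v) = chart_speed *: v psi.
Proof. by rewrite hom_coordE line_hom_unit. Qed.

(** If it vanished, every vector at [t] with given [phi]-coordinate would have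
    zero coordinate in the standard chart of the line, hence be zero. *)
Lemma chart_speed_neq0 : chart_speed != 0.
Proof.
apply/eqP => a0; have := of_coordK phi (const_mx 1).
have -> : of_coord phi (const_mx 1) = 0.
  apply: (tangent_coord_inj (line_chart_at t)) => /=.
  apply/rowP => j; rewrite mxE big_ord1 !ord1.
  by rewrite -[jacobian _ _ _ _]/chart_speed a0 mulr0 mxE.
by move/rowP/(_ 0); rewrite !mxE => /esym/eqP; rewrite oner_eq0.
Qed.

Lemma hom_coord_continuous : continuous (@hom_coord R 1 m _ M t p phi psi).
Proof.
have -> : @hom_coord R 1 m _ M t p phi psi =
    fun A => chart_speed *: A unit_tangent psi by apply/funext/hom_coordE.
move=> A.
have cA := continuous_comp (tangent_hom_eval_continuous unit_tangent A)
  (tangent_coord_continuous psi _).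
exact: (cvgZ (cvg_cst chart_speed) cA).
Qed.

(** A linear map out of the tangent line is determined by its value at d/dt, of
    which its matrix in the charts is the multiple by [chart_speed]. *)
Definition hom_of_coord (B : 'M[R]_(1, m)) : tangent_hom t p :=
  line_hom t (of_coord psi (chart_speed^-1 *: B)).

Lemma hom_coordK : cancel (@hom_coord R 1 m _ M t p phi psi) hom_of_coord.
Proof.
move=> A; rewrite /hom_of_coord hom_coordE scalerA mulVf ?chart_speed_neq0//.
by rewrite scale1r tangent_coordK -line_homE.
Qed.

Lemma hom_of_coord_continuous : continuous hom_of_coord.
Proof.
apply: tangent_hom_continuous => w; apply: tangent_continuous => c B.
rewrite /hom_of_coord /= /line_hom_fun.
have cB : chart_speed^-1 *: B' @[B' --> B] --> chart_speed^-1 *: B.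
  exact: (cvgZ (cvg_cst _) (@cvg_id _ (nbhs B))).
have cJ := cvg_mulmx _ cB (cvg_cst (jacobian (transition psi c) (psi p))).
exact: (cvgZ (cvg_cst (w (line_chart_at t) 0 0)) (cJ _ _)).
Qed.

End line_hom_coordinates.

(** * The curve in charts *)

(** The chain rule for one-sided derivatives, on slopes. *)
Lemma cvg_slope_comp {R : realType} {V : normedModType R} {F G : set_system R}
    {FF : Filter F} (k : R -> V) (s : R -> R) (a : R) (v : V) :
  k 0 = 0 -> s @ F --> G -> x^-1 * s x @[x --> F] --> a ->
  y^-1 *: k y @[y --> G] --> v ->
  x^-1 *: k (s x) @[x --> F] --> a *: v.
Proof.
move=> k0 sG sa kv.
have -> : (fun x => x^-1 *: k (s x)) =
    (fun x => (x^-1 * s x) *: ((s x)^-1 *: k (s x))).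
  apply/funext => x; have [->|sx0] := eqVneq (s x) 0.
    by rewrite k0 !scaler0.
  by rewrite scalerA mulfK.
by apply: cvgZ => //; exact: cvg_comp sG kv.
Qed.

Section oriented.
Context {R : realType} {s : R -> R} {a : R}.
Hypothesis s0 : s x @[x --> 0^'] --> 0.
Hypothesis sa : x^-1 * s x @[x --> 0^'] --> a.

Lemma cvg_pos_speed : 0 < a ->
  s x @[x --> 0^'+] --> 0^'+ /\ s x @[x --> 0^'-] --> 0^'-.
Proof.
move=> a0; split.
  apply: cvg_at_right0; first exact: cvg_dnbhs_at_right.
  have np : \forall x \near 0^'+, 0 < x^-1 * s x.
  exact: cvgr_gt a (cvg_dnbhs_at_right sa) 0 a0.
  near=> x; have x0 : 0 < x by [].
  have : 0 < x^-1 * s x by near: x.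
  by rewrite pmulr_rgt0// invr_gt0.
apply: cvg_at_left0; first exact: cvg_dnbhs_at_left.
have np : \forall x \near 0^'-, 0 < x^-1 * s x.
  exact: cvgr_gt a (cvg_dnbhs_at_left sa) 0 a0.
near=> x; have x0 : x < 0 by [].
have : 0 < x^-1 * s x by near: x.
by rewrite nmulr_rgt0// invr_lt0.
Unshelve. all: by end_near. Qed.

Lemma cvg_neg_speed : a < 0 ->
  s x @[x --> 0^'+] --> 0^'- /\ s x @[x --> 0^'-] --> 0^'+.
Proof.
move=> a0; split.
  apply: cvg_at_left0; first exact: cvg_dnbhs_at_right.
  have np : \forall x \near 0^'+, x^-1 * s x < 0.
  exact: cvgr_lt a (cvg_dnbhs_at_right sa) 0 a0.
  near=> x; have x0 : 0 < x by [].
  have : x^-1 * s x < 0 by near: x.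
  by rewrite pmulr_rlt0// invr_gt0.
apply: cvg_at_right0; first exact: cvg_dnbhs_at_left.
have np : \forall x \near 0^'-, x^-1 * s x < 0.
  exact: cvgr_lt a (cvg_dnbhs_at_left sa) 0 a0.
near=> x; have x0 : x < 0 by [].
have : x^-1 * s x < 0 by near: x.
by rewrite nmulr_rlt0// invr_lt0.
Unshelve. all: by end_near. Qed.

End oriented.

Section curve_in_charts.
Context {R : realType} {m : nat} {M : C1manifold R m}.
Context {f : R -> M} {t : R} {vl vr : tangent_space (f t)}.
Hypothesis cf : continuous f.
Hypothesis fl : is_left_derivative f t vl.
Hypothesis fr : is_right_derivative f t vr.
Context {phi : chart_at (t : real_line R)} {psi : chart_at (f t)}.
Hypothesis phi0 : phi t = 0.
Hypothesis psi0 : psi (f t) = 0.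

(* s is the inverse of phi, centered at t, and g the curve f in the charts. *)
Let s (x : R) : R := chart_inv phi (const_mx x) - t.
Let g (x : R) : 'rV[R]_m := psi (f (chart_inv phi (const_mx x))).
Let F := setmap_coord phi psi (fun s => [set f s]).

Let c0 : const_mx 0 = 0 :> 'rV[R]_1.
Proof. by apply/rowP => j; rewrite !mxE. Qed.

Let s0 : s 0 = 0.
Proof.
have [_ tphi] := svalP phi.
have : chart_inv phi 0 = t by rewrite -phi0 chart_mapK.
by rewrite /s c0 => ->; rewrite subrr.
Qed.

Let g0 : g 0 = 0.
Proof.
have [_ tphi] := svalP phi.
by rewrite /g c0 -phi0 chart_mapK.
Qed.

Let s_speed : x^-1 * s x @[x --> 0^'] --> chart_speed phi.
Proof.
have [Aphi tphi] := svalP phi.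
have [C1 _] := atlas_compatible Aphi (@line_chart_atlas R).
have [dT _] := C1 (phi t) (ex_intro2 _ _ (t : real_line R) (conj tphi I) erefl).
have := @diff_derivable _ _ _ _ _ (const_mx 1) dT.
rewrite /derivable => /cvg_ex[l ll].
have lE : l = 'd (transition phi (line_chart R)) (phi t) (const_mx 1).
  by rewrite -deriveE// /derive; apply/esym/cvg_lim.
have -> : chart_speed phi = l 0 0.
  rewrite lE -mul_rV_lin1 mxE big_ord1 mxE mul1r.
  by [].
have := cvg_comp _ _ ll (@coord_continuous R 1 1 0 0 l).
apply: cvg_trans; apply: near_eq_cvg; near=> x => /=.
have := s0; rewrite /s /transition /= phi0 addr0 scalemx_const mulr1 !mxE.
by rewrite c0 => /eqP; rewrite subr_eq0 => /eqP ->.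
Unshelve. all: by end_near. Qed.

Let s_cvg0 : s x @[x --> 0^'] --> 0.
Proof.
have xs : x * (x^-1 * s x) @[x --> 0^'] --> 0 * chart_speed phi.
  by apply: cvgM s_speed; exact: cvg_within.
rewrite mul0r in xs; apply: cvg_trans xs; apply: near_eq_cvg; near=> x.
have x0 : x != 0 by near: x; exact: nbhs_dnbhs_neq.
by rewrite mulrA divff// mul1r.
Unshelve. all: by end_near. Qed.

Let slope (G H : set_system R) {FG : Filter G} (v : tangent_space (f t)) :
  s @ G --> H -> x^-1 * s x @[x --> G] --> chart_speed phi ->
  h^-1 *: (psi (f (t + h)) - psi (f t)) @[h --> H] --> v psi ->
  x^-1 *: g x @[x --> G] --> hom_coord phi psi (line_hom t v).
Proof.
move=> sGH sG kv; rewrite hom_coord_line_hom.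
have gE x : g x = psi (f (t + s x)) - psi (f t).
  by rewrite psi0 subr0 /s subrKC.
under eq_cvg do rewrite gE.
apply: (cvg_slope_comp (fun y => psi (f (t + y)) - psi (f t)) s _ _ _
  sGH sG kv).
by rewrite addr0 subrr.
Qed.

(** A chart of the line may reverse it, which exchanges the two sides. *)
Lemma slopes_in_charts :
  (x^-1 *: g x @[x --> 0^'+] --> hom_coord phi psi (line_hom t vr) /\
   x^-1 *: g x @[x --> 0^'-] --> hom_coord phi psi (line_hom t vl)) \/
  (x^-1 *: g x @[x --> 0^'+] --> hom_coord phi psi (line_hom t vl) /\
   x^-1 *: g x @[x --> 0^'-] --> hom_coord phi psi (line_hom t vr)).
Proof.
have sr := cvg_dnbhs_at_right s_speed; have sl := cvg_dnbhs_at_left s_speed.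
have : (chart_speed phi < 0) || (0 < chart_speed phi).
  by rewrite -neq_lt chart_speed_neq0.
case/orP => a0.
  have [rl lr] := cvg_neg_speed s_cvg0 s_speed a0.
  by right; split; [exact: slope rl sr (fl psi)|exact: slope lr sl (fr psi)].
have [rr ll] := cvg_pos_speed s_cvg0 s_speed a0.
by left; split; [exact: slope rr sr (fr psi)|exact: slope ll sl (fl psi)].
Qed.

Lemma chart_ball : exists2 r, 0 < r & forall u, ball (0 : 'rV[R]_1) r u ->
  (phi @` chart_dom phi) u /\ chart_dom psi (f (chart_inv phi u)).
Proof.
have [_ tphi] := svalP phi; have [_ tpsi] := svalP psi.
have img0 : (phi @` chart_dom phi) 0 by rewrite -phi0; exists t.
have cinv : {for 0, continuous (chart_inv phi)} by exact: chart_inv_continuous.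
have inv0 : chart_inv phi 0 = t by rewrite -phi0 chart_mapK.
have near_img : \forall u \near (0 : 'rV[R]_1), (phi @` chart_dom phi) u.
  by apply: open_nbhs_nbhs; split => //; exact: chart_img_open.
have near_dom : \forall u \near (0 : 'rV[R]_1),
    chart_dom psi (f (chart_inv phi u)).
  have := continuous_comp cinv (cf (chart_inv phi 0)); apply.
  rewrite /= inv0; apply: open_nbhs_nbhs; split => //; exact: chart_dom_open.
have /nbhs_ballP[r r0 rP] : \forall u \near (0 : 'rV[R]_1),
    (phi @` chart_dom phi) u /\ chart_dom psi (f (chart_inv phi u)).
  exact: filterI near_img near_dom.
by exists r => // u /rP.
Qed.

Let FE u : chart_dom psi (f (chart_inv phi u)) -> F u = [set g (u 0 0)].
Proof.
move=> du; have uE : const_mx (u 0 0) = u.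
  by apply/rowP => j; rewrite mxE ord1.
apply/seteqP; split=> [_ [_ [_ ->] <-]|_ ->]; rewrite /g uE//.
by exists (f (chart_inv phi u)).
Qed.

(** When [phi] reverses the line, the slopes on the two sides are exchanged and the
    path is run through in the opposite sense. *)
Lemma manifold_QDQ_of_arc (Lambda : set (tangent_hom (t : real_line R) (f t))) :
  compact Lambda ->
  (exists2 A, is_arc R (line_hom t vr) (line_hom t vl) A & A `<=` Lambda) ->
  is_manifold_QDQ phi psi (fun s => [set f s]) Lambda setT.
Proof.
move=> cL [A arcA AL]; split=> //.
have [p [cp pA pr pl]] := arc_path arcA.
have [r r0 rP] := chart_ball.
have cg x : `|x| < r -> {for x, continuous g}.
  move=> xr; have [|img dom] := rP (const_mx x).
    by apply/ball_rV1; rewrite mxE.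
  have cinv : {for const_mx x, continuous (chart_inv phi)}.
    exact: chart_inv_continuous.
  have cfinv := continuous_comp (continuous_comp (const_mx_continuous x) cinv)
    (cf _).
  exact: (continuous_comp cfinv (chart_map_continuous dom)).
have Fg u : ball 0 r u -> F u (g (u 0 0)) by move=> /rP[_ du]; rewrite FE.
have cHL : compact (hom_coord phi psi @` Lambda).
  apply: continuous_compact cL; apply: continuous_subspaceT.
  exact: hom_coord_continuous.
have cHp : continuous (hom_coord phi psi \o p).
  by move=> x; exact: continuous_comp (cp x) (hom_coord_continuous _ _ _).
have HL x : (hom_coord phi psi @` Lambda) (hom_coord phi psi (p x)).
  by exists (p x) => //; exact: AL.
case: slopes_in_charts => -[gr gl].
  apply: (QDQ_of_path g _ _ g0 gr gl _ _ _ r r0 (hom_coord phi psi \o p)) => //.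
  - by move=> x x1 /=; rewrite pr.
  - by move=> x x1 /=; rewrite pl.
apply: (QDQ_of_path g _ _ g0 gr gl _ _ _ r r0
  (hom_coord phi psi \o p \o -%R)) => //.
- by move=> x; apply: continuous_comp (cHp _); exact: opp_continuous.
- by move=> x; exact: HL.
- by move=> x x1 /=; rewrite pl// lerN2.
- by move=> x x1 /=; rewrite pr// lerNr.
Qed.

Lemma connected_of_manifold_QDQ
    (Lambda : set (tangent_hom (t : real_line R) (f t))) :
  is_manifold_QDQ phi psi (fun s => [set f s]) Lambda setT ->
  exists C, [/\ connected C, C `<=` Lambda &
    [set line_hom t vr; line_hom t vl] `<=` C].
Proof.
move=> [cL qL]; have [r r0 rP] := chart_ball.
have Fg u : ball 0 r u -> F u `<=` [set g (u 0 0)] by move=> /rP[_ du]; rewrite FE.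
have rG : ball 0 r `<=` phi @` (setT `&` chart_dom phi).
  by rewrite setTI => u /rP[].
have [C [cC CL Cr Cl]] : exists C, [/\ connected C,
    C `<=` hom_coord phi psi @` Lambda,
    C (hom_coord phi psi (line_hom t vr)) &
    C (hom_coord phi psi (line_hom t vl))].
  case: slopes_in_charts => -[gr gl].
    exact: (connected_of_QDQ g _ _ gr gl _ _ _ r r0 Fg rG qL).
  have [C [cC CL Cr Cl]] :=
    connected_of_QDQ g _ _ gr gl _ _ _ r r0 Fg rG qL.
  by exists C.
exists (hom_of_coord phi psi @` C); split.
- apply: connected_continuous_connected cC _; apply: continuous_subspaceT.
  exact: hom_of_coord_continuous.
- by move=> _ [B /CL[A LA <-] <-]; rewrite hom_coordK.
- move=> A [->|->].
    by exists (hom_coord phi psi (line_hom t vr)) => //; exact: hom_coordK.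
  by exists (hom_coord phi psi (line_hom t vl)) => //; exact: hom_coordK.
Qed.

End curve_in_charts.

Theorem mainTheorem3 (R : realType) (m : nat) (M : C1manifold R m)
    (f : R -> M) (t : R) (vl vr : tangent_space (f t)) :
  continuous f ->
  is_left_derivative f t vl -> is_right_derivative f t vr ->
  forall (phi : chart_at (t : real_line R)) (psi : chart_at (f t)),
  phi t = 0 -> psi (f t) = 0 ->
  (forall Lambda : set (tangent_hom (t : real_line R) (f t)),
     compact Lambda ->
     (exists2 A, is_arc R (line_hom t vr) (line_hom t vl) A & A `<=` Lambda) ->
     is_manifold_QDQ phi psi (fun s => [set f s]) Lambda setT) /\
  (forall Lambda : set (tangent_hom (t : real_line R) (f t)),
     is_manifold_QDQ phi psi (fun s => [set f s]) Lambda setT ->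
     exists C, [/\ connected C, C `<=` Lambda &
       [set line_hom t vr; line_hom t vl] `<=` C]).
Proof.
move=> cf fl fr phi psi phi0 psi0; split=> Lambda.
  exact: (manifold_QDQ_of_arc cf fl fr phi0 psi0 Lambda).
exact: (connected_of_manifold_QDQ cf fl fr phi0 psi0 Lambda).
Qed.
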